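(* Let $E=\bigsqcup_{n\in\omega}E_n$ be a continuous signature and let $X$ be a semitopological $E$-algebra with structure maps $\mathfrak e^X_n\colon E_n\times X^n\to X$. Suppose that $X$ is pseudocompact, that the pair $(X,E)$ is Grothendieck, and that for every $n\in\mathrm{Sp}\,E$ and every $f\in E_n$ the operation $f^X\colon X^n\to X$ is $2$-quasicontinuous. Then the operations of $X$ extend to separately continuous operations on $\beta X$ (that is, each $\mathfrak e^X_n$ extends to a separately continuous map $E_n\times(\beta X)^n\to\beta X$), with respect to which $\beta X$ is a semitopological $E$-algebra.
   Context: All spaces are Tychonoff; $\beta X$ is the Stone–Čech compactification. A continuous signature is a space $E$ that is the disjoint union of clopen (possibly empty) subsets $E_n$, $n\in\omega=\{0,1,2,\dots\}$; $\mathrm{Sp}\,E=\{n\in\omega: E_n\ne\varnothing\}$. An $E$-algebra is a set $X$ with maps $\mathfrak e^X_n\colon E_n\times X^n\to X$, $n\in\omega$ ($X^0$ is a singleton); for $f\in E_n$ the operation $f^X\colon X^n\to X$ is $f^X(\bar x)=\mathfrak e^X_n(f,\bar x)$. A semitopological $E$-algebra is an $E$-algebra endowed with a topology such that every $\mathfrak e^X_n$ is separately continuous, i.e. continuous in each of its $n+1$ arguments (the one in $E_n$ and the $n$ ones in $X$) when the others are fixed. A pair of spaces $(S,T)$ is Grothendieck if for every continuous map $\varphi\colon S\to C_p(T)$ the closure of $\varphi(S)$ in $C_p(T)$ is compact; $C_p(T)$ is the space of continuous real-valued functions on $T$ with the topology of pointwise convergence. A map $f\colon S\to T$ is quasicontinuous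 if for every $x\in S$, every neighborhood $O$ of $f(x)$ and every neighborhood $W$ of $x$ there is a nonempty open $U\subset W$ with $f(U)\subset O$. A map $\Phi\colon\prod_{\alpha\in A}X_\alpha\to Y$ is $2$-quasicontinuous if for every $B\subset A$ with $|B|\le 2$ and every fixed choice of coordinates $(x_\alpha)_{\alpha\in A\setminus B}$, the resulting map $\prod_{\alpha\in B}X_\alpha\to Y$, $(x_\alpha)_{\alpha\in B}\mapsto\Phi((x_\alpha)_{\alpha\in A})$, is quasicontinuous. *)

(* Defs.v *)
From HB Require Import structures.
From mathcomp Require Import all_boot all_order all_algebra.
From mathcomp Require Import all_classical reals topology normedtype.

Set Implicit Arguments.
Unset Strict Implicit.
Unset Printing Implicit Defensive.

Import Order.TTheory GRing.Theory Num.Theory.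
Import numFieldNormedType.Exports.

Local Open Scope classical_set_scope.
Local Open Scope ring_scope.

Definition tychonoff_space (T : topologicalType) : Prop :=
  completely_regular_space T /\ hausdorff_space T.

Definition pseudocompact (R : realType) (T : topologicalType) : Prop :=
  forall f : T -> R, continuous f -> bounded_fun f.

(* The library puts no default topology on [continuousType T R]; this alias
   carries the one induced by the inclusion into the power R^T. *)
Definition Cp (R : realType) (T : topologicalType) : topologicalType :=
  initial_topology
    (fun g : continuousType T R => (g : T -> R) : {ptws T -> R}).

Definition grothendieck_pair (R : realType) (S T : topologicalType) : Prop :=
  forall phi : S -> Cp R T, continuous phi -> compact (closure (range phi)).

Definition quasicontinuous (S T : topologicalType) (f : S -> T) : Prop :=
  forall (x : S) (O : set T) (W : set S), nbhs (f x) O -> nbhs x W ->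
    exists U : set S, [/\ open U, U !=set0, U `<=` W & f @` U `<=` O].

(* [z] on the coordinates in [B], [x] on the others. *)
Definition glue_coords (I : Type) (T : I -> Type) (B : set I)
    (x : forall i, T i) (z : forall b : B, T (val b)) : forall i, T i :=
  fun i => match (i \in B) =P true with
           | ReflectT iB => z (SigSub iB)
           | ReflectF _ => x i
           end.

(* The fixed coordinates are given as a full point [x], of which [glue_coords]
   only uses the coordinates outside [B]. This loses nothing: a choice of
   coordinates outside [B] extends to a full point unless the product over [B]
   is empty, and then the map on that product is vacuously quasicontinuous. *)
Definition two_quasicontinuous (I : Type) (T : I -> topologicalType)
    (Y : topologicalType) (Phi : (forall i, T i) -> Y) : Prop :=
  forall (B : set I) (x : forall i, T i), (B #<= `I_2)%card ->
    @quasicontinuous (prod_topology (fun b : B => T (val b))) Y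
      (fun z => Phi (glue_coords x z)).

Section signature.
Context (E : topologicalType) (En : nat -> set E).

Definition continuous_signature : Prop :=
  [/\ tychonoff_space E,
      forall n, clopen (En n),
      trivIset [set: nat] En &
      \bigcup_n En n = [set: E] ].

Definition Sp : set nat := [set n | En n !=set0].

(* The points of X^n are the functions ['I_n -> X]; [En n] stands for the type
   of its points, with the subspace topology. *)
Definition E_algebra (X : Type) : Type :=
  forall n : nat, En n -> ('I_n -> X) -> X.

Definition semitopological (X : topologicalType) (op : E_algebra X) : Prop :=
  forall n : nat,
    (forall x : 'I_n -> X, continuous (fun f : En n => op n f x)) /\
    (forall (f : En n) (x : 'I_n -> X) (i : 'I_n),
       continuous (fun y : X => op n f (dfwith x i y))).

End signature.

(* Stone-Cech compactification: the closure of the canonical image of X in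
   the Tychonoff cube [0,1]^C(X,[0,1]). *)
Section stone_cech.
Context (R : realType) (X : topologicalType).

Definition unit_interval : topologicalType :=
  set_type `[0 : R, 1 : R]%classic.

Definition tychonoff_cube : topologicalType :=
  {ptws continuousType X unit_interval -> unit_interval}.

Definition cube_eval (x : X) : tychonoff_cube := fun g => g x.

Definition stone_cech : topologicalType :=
  set_type (closure (range cube_eval)).

Definition stone_cech_unit (x : X) : stone_cech :=
  SigSub (mem_set (subset_closure (imageT cube_eval x))).

End stone_cech.

(* Main.v *)
(* The operation is extended to the Stone-Cech compactification one coordinate
   at a time, by continuous extension in that coordinate. Separate continuity
   survives because no pair of coordinates admits a "crossing", i.e. two
   sequences s, t and a < b with F(s_i, t_j) <= a for i <= j and >= b for j < i:
   - a quasicontinuous separately continuous function on a product of two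
     pseudocompact spaces has no crossing (a Namioka-type argument, replacing
     limit points of sequences by cluster points of sequences of open sets);
   - without crossings, pointwise limits in one variable are continuous in the
     other (Grothendieck's double limit criterion);
   - a crossing involves countably many functions, and X meets every nonempty
     G_delta set of its compactification, so a crossing after extending one
     coordinate gives a crossing before.
   Only two coordinates enter at a time, whence 2-quasicontinuity suffices.
   Continuity in the signature is preserved by the Grothendieck property. *)
Require Import Defs.
From mathcomp Require Import all_boot all_order all_algebra.
From mathcomp Require Import all_classical reals topology normedtype.

Set Implicit Arguments.
Unset Strict Implicit.
Unset Printing Implicit Defensive.

Import Order.TTheory GRing.Theory Num.Theory.
Import numFieldNormedType.Exports.

Local Open Scope classical_set_scope.
Local Open Scope ring_scope.

(** * Sequences of open sets *)

Lemma dependent_choice_on (S : Type) (P : S -> Prop) (Q : S -> S -> Prop)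
    (s0 : S) :
  P s0 -> (forall s, P s -> exists2 s', P s' & Q s s') ->
  exists2 u : nat -> S, forall n, P (u n) & forall n, Q (u n) (u n.+1).
Proof.
move=> Ps0 step.
have step' (s : {s | P s}) : {s' : {s | P s} | Q (sval s) (sval s')}.
  by apply: cid; case: (step _ (svalP s)) => s' Ps' Qs'; exists (exist _ _ Ps').
have [u [_ Qu]] := dependent_choice step' (exist _ _ Ps0).
by exists (fun n => sval (u n)) => // n; exact: svalP.
Qed.

Lemma nested_subset (T : Type) (S : nat -> set T) :
  (forall n, S n.+1 `<=` S n) -> forall m n, (m <= n)%N -> S n `<=` S m.
Proof.
move=> nS m n /subnKC <-; elim: (n - m)%N => [|d IH]; first by rewrite addn0.
by rewrite addnS; apply: subset_trans (nS _) IH.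
Qed.

Definition seq_cluster (T : topologicalType) (U : nat -> set T) (x : T) :=
  forall W, nbhs x W -> forall m, exists2 n, (m <= n)%N & U n `&` W !=set0.

(** The form in which pseudocompactness enters the arguments below; [pseudocompact_feebly_compact]
    derives it for completely regular spaces. *)
Definition feebly_compact (T : topologicalType) :=
  forall U : nat -> set T, (forall n, open (U n)) -> (forall n, U n !=set0) ->
    exists x, seq_cluster U x.

(** * Separately continuous functions of two variables *)

Section two_variables.
Context (R : realType).

Lemma seq_cluster_le (T : topologicalType) (U : nat -> set T) (x : T)
    (f : T -> R) (b : R) (m : nat) :
  seq_cluster U x -> {for x, continuous f} ->
  (forall n y, (m <= n)%N -> U n y -> f y <= b) -> f x <= b.
Proof.
move=> Ux cf fb; rewrite leNgt; apply/negP => bfx.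
have [n mn [y [Uy /= by_]]] := Ux _ (cf _ (lt_nbhsr bfx)) m.
by have := fb n y mn Uy; rewrite leNgt by_.
Qed.

Lemma seq_cluster_ge (T : topologicalType) (U : nat -> set T) (x : T)
    (f : T -> R) (b : R) (m : nat) :
  seq_cluster U x -> {for x, continuous f} ->
  (forall n y, (m <= n)%N -> U n y -> b <= f y) -> b <= f x.
Proof.
move=> Ux cf fb; rewrite -lerN2.
apply: (seq_cluster_le (m := m) (f := fun y => - f y) Ux); first exact: cvgN.
by move=> n y mn Uy; rewrite lerN2; exact: (fb n).
Qed.

Definition separately_continuous (S T U : topologicalType) (F : S -> T -> U) :=
  (forall y, continuous (fun x => F x y)) /\ (forall x, continuous (F x)).

(** Quasicontinuity of the uncurried map, with the open set taken as a box; boxes form a base of the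
    product. *)
Definition box_quasicontinuous (S T U : topologicalType) (F : S -> T -> U) :=
  forall x y O A B, nbhs (F x y) O -> nbhs x A -> nbhs y B ->
    exists C D, [/\ open C, open D, C !=set0, D !=set0 &
      [/\ C `<=` A, D `<=` B & forall u v, C u -> D v -> O (F u v)]].

Lemma open_ltc (T : topologicalType) (f : T -> R) (b : R) :
  continuous f -> open [set x | f x < b].
Proof. by move=> cf; apply: (open_comp _ (@open_lt R b)) => x _; exact: cf. Qed.

Lemma open_gtc (T : topologicalType) (f : T -> R) (b : R) :
  continuous f -> open [set x | b < f x].
Proof. by move=> cf; apply: (open_comp _ (@open_gt R b)) => x _; exact: cf. Qed.

(** Otherwise one finds shrinking open [U n] with points [x n], and open [V n], such that
    [F (x i) < b1] on all later [V n] and [F > b] on [U n] times [V n]. A cluster point [y0] of the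
    [V n] has [F (x i) y0 <= b1] for all [i]; a cluster point of the sets [U n] cut down to
    [F _ y0 < b2] then gives a value that is at most [b2] and at least [b]. *)
Lemma quasicontinuous_small_box (S T : topologicalType) (F : S -> T -> R)
    (L : set_system T) (g : S -> R) (W : set S) (w : S) (b : R) :
  feebly_compact S -> feebly_compact T ->
  separately_continuous F -> box_quasicontinuous F ->
  ProperFilter L -> continuous g -> (forall x, F x @ L --> g x) ->
  open W -> W w -> g w < b ->
  exists U V, [/\ open U, U !=set0 & U `<=` W] /\
    [/\ open V, L V & forall u v, U u -> V v -> F u v <= b].
Proof.
move=> fS fT [cF1 cF2] qF PL cg Fg oW Ww gwb; apply: contrapT => H.
have [b1 [gb1 b1b]] : exists b1, g w < b1 /\ b1 < b.
  by exists ((g w + b) / 2); rewrite midf_lt// midf_lt.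
have [b2 [b12 b2b]] : exists b2, b1 < b2 /\ b2 < b.
  by exists ((b1 + b) / 2); rewrite midf_lt// midf_lt.
(* A state holds an open [U] with a point [x] in it, an open [N] in [L] and the last [V]; [P] is the
   invariant and [Q] the transition. *)
pose P (s : set S * set T * S * set T) := let: (U, N, x, V) := s in
  [/\ open U, U `<=` W `&` [set x | g x < b1] & U x] /\ (open N /\ L N).
pose Q (s s' : set S * set T * S * set T) :=
  let: (U, N, x, V) := s in let: (U', N', x', V') := s' in
  [/\ U' `<=` U, N' `<=` N & forall y, N' y -> F x y < b1] /\
  [/\ open V', V' !=set0, V' `<=` N' & forall u v, U' u -> V' v -> b < F u v].
have Ps0 : P (W `&` [set x | g x < b1], setT, w, setT).
  split; last by split; [exact: openT|exact: filterT].
  by split => //; apply: openI => //; exact: open_ltc.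
case: (dependent_choice_on (Q := Q) Ps0).
  move=> [[[U N] x] V] /= [[oU UW Ux] [oN LN]].
  pose N' := N `&` [set y | F x y < b1].
  have oN' : open N' by apply: openI => //; exact: open_ltc.
  have LN' : L N'.
    apply: filterI => //; have [_ gx] := UW _ Ux.
    exact: (Fg x _ (lt_nbhsl gx)).
  (* Without such a point, [U] and [N'] would form the box excluded by [H]. *)
  have [u [v [Uu Nv Fuv]]] : exists u v, [/\ U u, N' v & b < F u v].
    apply: contrapT => H'; apply: H; exists U, N'; split.
      by split => //; [exists x|move=> z /UW[]].
    split => // u v Uu Nv; rewrite leNgt; apply/negP => bF.
    by apply: H'; exists u, v.
  have [C [D [oC oD C0 D0 [CU DN CD]]]] := qF u v _ U N' (lt_nbhsr Fuv)
    (open_nbhs_nbhs (conj oU Uu)) (open_nbhs_nbhs (conj oN' Nv)).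
  have [c Cc] := C0.
  exists (C, N', c, D); split => //; last first.
    by split => // y [].
  by split => // z /CU /UW.
move=> s Ps Qs.
pose U n := (s n).1.1.1; pose N n := (s n).1.1.2; pose x n := (s n).1.2.
pose V n := (s n).2.
have {}Ps n : open (U n) /\ U n (x n).
  by move: (Ps n); rewrite /P /U /x; case: (s n) => -[[? ?] ?] ? [[? ? ?] ?].
have {}Qs n : [/\ U n.+1 `<=` U n, N n.+1 `<=` N n &
      forall y, N n.+1 y -> F (x n) y < b1] /\
    [/\ open (V n.+1), V n.+1 !=set0, V n.+1 `<=` N n.+1 &
      forall u v, U n.+1 u -> V n.+1 v -> b < F u v].
  move: (Qs n); rewrite /Q /U /N /x /V.
  by case: (s n) => -[[? ?] ?] ?; case: (s n.+1) => -[[? ?] ?] ?.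
have nU := nested_subset (fun n => let: conj (And3 h _ _) _ := Qs n in h).
have nN := nested_subset (fun n => let: conj (And3 _ h _) _ := Qs n in h).
(* The initial [V 0] is a dummy, so the sequence starts at [V 1]. *)
have [y0 Vy0] : exists y, seq_cluster (fun n => V n.+1) y.
  by apply: fT => n; have [_ []] := Qs n.
have Fxy0 i : F (x i) y0 <= b1.
  apply: (seq_cluster_le (m := i) Vy0); first exact: cF2.
  move=> n y in_ Vy; have [[_ _ +] _] := Qs i; move=> /(_ y) Fi.
  apply/ltW/Fi/(nN i.+1 n.+1) => //.
  by have [_ [_ _ + _]] := Qs n; apply.
(* Pseudocompactness provides cluster points of sequences of open sets only, so
   [x i] is thickened to [G `&` U i], which became possible once [y0] was found. *)
pose G := [set z | F z y0 < b2].
have oG : open G by exact: open_ltc.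
have [x0 Gx0] : exists z, seq_cluster (fun n => G `&` U n) z.
  apply: fS => n; first by apply: openI => //; have [] := Ps n.
  by exists (x n); split; [exact: le_lt_trans (Fxy0 n) b12|have [] := Ps n].
have h1 : F x0 y0 <= b2.
  apply: (seq_cluster_le (m := 0) (f := F ^~ y0) Gx0); first exact: cF1.
  by move=> n y _ [/ltW].
have h2 : b <= F x0 y0.
  apply: (seq_cluster_ge (m := 0) Vy0); first exact: cF2.
  move=> n y _ Vy.
  apply: (seq_cluster_ge (m := n.+1) (f := F ^~ y) Gx0); first exact: cF1.
  move=> m z nm [_ Uz]; have [_ [_ _ _ /(_ z y)]] := Qs n.
  by move=> h; apply: ltW; apply: h => //; exact: nU Uz.
by have := lt_le_trans b2b (le_trans h2 h1); rewrite ltxx.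
Qed.


(** Back and forth: [i_ n] is taken in a [Q]-large set on which [hi] holds for all earlier [y_],
    then [y_ n] in [B] and in the [L]-large intersection of the sets [lo] found so far. Abstract [Q]
    and [I] allow the indices to be points as well as boxes of open sets. *)
Lemma alternating_sequences (I T : Type) (Q : set_system I) (L : set_system T)
    (B : set T) (lo hi : I -> set T) :
  Filter L -> Q setT ->
  (forall A, Q A -> exists2 i, A i & L (lo i)) ->
  (forall y A, B y -> Q A -> Q (A `&` [set i | hi i y])) ->
  (forall N, L N -> exists2 y, N y & B y) ->
  exists (i_ : nat -> I) (y_ : nat -> T), [/\ forall n, L (lo (i_ n)),
    forall m n, (m <= n)%N -> lo (i_ m) (y_ n),
    forall m n, (n < m)%N -> hi (i_ m) (y_ n) & forall n, B (y_ n)].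
Proof.
move=> FL QT Qlo Qhi LB.
pose P (s : set I * set T * I * T) := let: (A, N, i, y) := s in
  [/\ Q A, L N & L (lo i)] /\ [/\ N `<=` lo i, N y, B y & A `<=` hi^~ y].
pose S (s s' : set I * set T * I * T) :=
  let: (A, N, i, y) := s in let: (A', N', i', y') := s' in
  [/\ A' `<=` A, N' `<=` N & A i'].
have step A N : Q A -> L N ->
    exists2 s, P s & let: (A', N', i', y') := s in
      [/\ A' `<=` A, N' `<=` N & A i'].
  move=> QA LN; have [i Ai Li] := Qlo _ QA.
  have [y [Ny ly] By] := LB _ (filterI LN Li).
  exists (A `&` [set i | hi i y], N `&` lo i, i, y); last by split => // z [].
  by split; split => //; [exact: Qhi|exact: filterI].
have [s0 Ps0 _] := step setT setT QT filterT.
case: (dependent_choice_on (Q := S) Ps0).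
  by move=> [[[A N] i] y] /= [[QA LN _] _]; exact: step.
move=> s Ps Ss.
pose A n := (s n).1.1.1; pose N n := (s n).1.1.2; pose i n := (s n).1.2.
pose y n := (s n).2.
have {}Ps n : L (lo (i n)) /\ [/\ N n `<=` lo (i n), N n (y n), B (y n) &
    A n `<=` hi^~ (y n)].
  by move: (Ps n); rewrite /P /A /N /i /y; case: (s n) => -[[? ?] ?] ? [[]].
have {}Ss n : [/\ A n.+1 `<=` A n, N n.+1 `<=` N n & A n (i n.+1)].
  move: (Ss n); rewrite /S /A /N /i.
  by case: (s n) => -[[? ?] ?] ?; case: (s n.+1) => -[[? ?] ?] ?.
have nA := nested_subset (fun n => let: And3 h _ _ := Ss n in h).
have nN := nested_subset (fun n => let: And3 _ h _ := Ss n in h).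
exists i, y; split => [n|m n mn|[//|m] n nm|n].
- by have [] := Ps n.
- by have [_ [+ _ _ _]] := Ps m; apply; apply: nN mn _ _; have [_ []] := Ps n.
- by have [_ [_ _ _]] := Ps n; apply; apply: (nA n m nm); have [] := Ss m.
- by have [_ []] := Ps n.
Qed.

(** Otherwise every set of [L] meets [k > b]. Alternating between boxes from
    [quasicontinuous_small_box] and points with [k > b] gives a crossing whose first entries are
    open sets; cluster points [x0] and [y0] then satisfy [b2 <= F x0 y0 <= b1], against
    [b1 < b2]. *)
Lemma iterated_limit_le (S T : topologicalType) (F : S -> T -> R)
    (K : set_system S) (L : set_system T) (g : S -> R) (k : T -> R) (a b : R) :
  feebly_compact S -> feebly_compact T ->
  separately_continuous F -> box_quasicontinuous F ->
  ProperFilter K -> ProperFilter L ->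
  continuous g -> (forall x, F x @ L --> g x) ->
  (forall y, F^~ y @ K --> k y) -> g @ K --> a -> a < b ->
  \forall y \near L, k y <= b.
Proof.
move=> fS fT sF qF PK PL cg Fg Fk ga ab; apply: contrapT => nk.
have [cF1 cF2] := sF.
have [b1 [ab1 b1b]] : exists b1, a < b1 /\ b1 < b.
  by exists ((a + b) / 2); rewrite midf_lt// midf_lt.
have [b2 [b12 b2b]] : exists b2, b1 < b2 /\ b2 < b.
  by exists ((b1 + b) / 2); rewrite midf_lt// midf_lt.
pose good (p : set S * set T) := [/\ open p.1, p.1 !=set0, open p.2 &
  forall u v, p.1 u -> p.2 v -> F u v <= b1].
(* A set of boxes is large if it contains all good boxes over some open set of [K]. The first side
   of a good box need not itself belong to [K]. *)
pose Q (C : set (set S * set T)) := exists2 O, open O /\ K O &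
  forall p, good p -> p.1 `<=` O -> C p.
have [p_ [y_ [Lp lo hi kb]]] :
  exists (p_ : nat -> set S * set T) (y_ : nat -> T),
   [/\ forall n, L (p_ n).2, forall m n, (m <= n)%N -> (p_ m).2 (y_ n),
    forall m n, (n < m)%N ->
      good (p_ m) /\ forall u, (p_ m).1 u -> b < F u (y_ n) &
    forall n, b < k (y_ n)].
  apply: (@alternating_sequences _ _ Q L [set y | b < k y] snd
    (fun p => [set y | good p /\ forall u, p.1 u -> b < F u y])).
  - by exists setT => //; split; [exact: openT|exact: filterT].
  - move=> A [O [oO KO] OA].
    have Kg : K [set x | g x < b1] by exact: (ga _ (lt_nbhsl ab1)).
    have [w [Ow gw]] := filter_ex (filterI KO Kg).
    have [U [V [[oU U0 UO] [oV LV UV]]]] :=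
      quasicontinuous_small_box fS fT sF qF PL cg Fg oO Ow gw.
    by exists (U, V) => //; apply: OA.
  - move=> y A yb [O [oO KO] OA].
    exists (O `&` [set x | b < F x y]).
      split; first by apply: openI => //; exact: open_gtc.
      by apply: filterI => //; exact: (Fk y _ (lt_nbhsr yb)).
    move=> p gp pO; split; first by apply: OA => // z /pO[].
    by split => // u /pO[].
  - move=> N LN; apply: contrapT => H; apply: nk; apply: filterS LN => y Ny.
    by rewrite leNgt; apply/negP => yb; apply: H; exists y.
(* [hi] speaks only of indices above some [n], so [p_ 0] need not be good; hence the shift by
   one. *)
have gp n : good (p_ n.+1) by have [] := hi n.+1 n (ltnSn n).
have [x0 Ux0] : exists x, seq_cluster (fun n => (p_ n.+1).1) x.
  by apply: fS => n; have [] := gp n.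
have Fx0 n : b <= F x0 (y_ n).
  apply: (seq_cluster_ge (m := n) (f := F ^~ (y_ n)) Ux0); first exact: cF1.
  by move=> m z nm Uz; have [_ h] := hi m.+1 n nm; exact/ltW/h.
(* The point [y_ n] lies in [N n], because [m < n] means [m.+1 <= n] in [lo]. *)
pose N n := [set y | b2 < F x0 y] `&` \bigcap_(m in `I_n) (p_ m.+1).2.
have [y0 Ny0] : exists y, seq_cluster N y.
  apply: fT => n.
    apply: openI; first exact: open_gtc.
    rewrite bigcap_mkord; elim/big_ind: _ => [|A B|i _]; first exact: openT.
      exact: openI.
    by have [] := gp i.
  exists (y_ n); split; first exact: lt_le_trans b2b (Fx0 n).
  by move=> m /= mn; apply: lo.
have h1 : b2 <= F x0 y0.
  apply: (seq_cluster_ge (m := 0) Ny0); first exact: cF2.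
  by move=> n y _ [/ltW].
have h2 : F x0 y0 <= b1.
  apply: (seq_cluster_le (m := 0) (f := F ^~ y0) Ux0); first exact: cF1.
  move=> n u _ Uu; apply: (seq_cluster_le (m := n.+1) Ny0); first exact: cF2.
  move=> m y nm [_ /(_ n nm) Ny]; have [_ _ _] := gp n; exact.
by have := lt_le_trans b12 (le_trans h1 h2); rewrite ltxx.
Qed.

Lemma near_le_cvg (T : Type) (L : set_system T) (f : T -> R) (a : R) :
  Filter L -> (forall b, a < b -> \forall x \near L, f x <= b) ->
  (forall b, b < a -> \forall x \near L, b <= f x) -> f @ L --> a.
Proof.
move=> FL le_ ge_; apply/cvgrPdist_le => e e0.
have le1 : \forall x \near L, f x <= a + e by apply: le_; rewrite ltrDl.
have ge1 : \forall x \near L, a - e <= f x by apply: ge_; rewrite ltrBlDr ltrDl.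
apply: filterS (filterI le1 ge1) => x [{}le1 {}ge1].
by rewrite distrC ler_distl ge1 le1.
Qed.

Lemma box_quasicontinuous_comp (S T U V : topologicalType) (F : S -> T -> U)
    (h : U -> V) :
  continuous h -> box_quasicontinuous F ->
  box_quasicontinuous (fun x y => h (F x y)).
Proof. by move=> ch qF x y O A B /ch; exact: qF. Qed.

Lemma separately_continuous_comp (S T U V : topologicalType) (F : S -> T -> U)
    (h : U -> V) :
  continuous h -> separately_continuous F ->
  separately_continuous (fun x y => h (F x y)).
Proof.
move=> ch [c1 c2]; split=> z y.
  by apply: continuous_comp; [exact: c1|exact: ch].
by apply: continuous_comp; [exact: c2|exact: ch].
Qed.

Lemma continuous_opp : continuous (@GRing.opp R).
Proof. by move=> x; apply: cvgN. Qed.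

(** Take the neighborhood filter of [y0] for [L] and [F ^~ y0] for [g] in [iterated_limit_le]: [F]
    gives upper and [- F] lower semicontinuity. *)
Lemma pointwise_limit_continuous (S T : topologicalType) (F : S -> T -> R)
    (K : set_system S) (k : T -> R) :
  feebly_compact S -> feebly_compact T ->
  separately_continuous F -> box_quasicontinuous F ->
  ProperFilter K -> (forall y, F^~ y @ K --> k y) -> continuous k.
Proof.
move=> fS fT sF qF PK Fk y0; have [cF1 cF2] := sF.
apply: near_le_cvg => b kb.
  apply: (iterated_limit_le fS fT sF qF (g := F ^~ y0)) (Fk) (Fk y0) kb.
    exact: cF1.
  by move=> x; exact: cF2.
have sF' := separately_continuous_comp continuous_opp sF.
have qF' := box_quasicontinuous_comp continuous_opp qF.
have := iterated_limit_le fS fT sF' qF' (g := fun x => - F x y0)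
  (k := fun y => - k y) (a := - k y0) (b := - b) (L := nbhs y0) PK _ _ _ _ _ _.
rewrite ltrN2 => H; have : \forall y \near y0, - k y <= - b.
  apply: H => //; first by case: sF'.
  - by move=> x; apply: cvgN; exact: cF2.
  - by move=> y; apply: cvgN; exact: Fk.
  - by apply: cvgN; exact: Fk.
by apply: filterS => y; rewrite lerN2.
Qed.

(** * Crossings and Grothendieck's double limit criterion *)

Lemma ultrafilter_bounded_cvg (I : Type) (U : set_system I) (f : I -> R) (c : R) :
  UltraFilter U -> (forall i, `|f i| <= c) -> exists l : R, f @ U --> l.
Proof.
move=> UU fc.
have [|l [_ Ul]] := @segment_compact R (- c) c (f @ U).
  by apply: (@filterE _ U) => i; rewrite /= in_itv /= -ler_norml.
exists l => A Al.
have [//|UA] := in_ultra_setVsetC (f @^-1` A) UU.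
by have [x [nAx Ax]] := Ul (~` A) A UA Al.
Qed.

Definition crossing (S T : Type) (F : S -> T -> R) :=
  exists (s : nat -> S) (t : nat -> T) (a b : R), [/\ a < b,
    forall i j, (i <= j)%N -> F (s i) (t j) <= a &
    forall i j, (j < i)%N -> b <= F (s i) (t j)].

(** Along a free ultrafilter, [F (s i) _] tends to [k] and [F _ (t j)] to [g], which is continuous
    by [pointwise_limit_continuous] with the variables exchanged. Since [g (s i) <= a],
    [iterated_limit_le] yields some [j] with [k (t j) < b], whereas [k (t j) >= b] for all [j]. *)
Lemma quasicontinuous_not_crossing (S T : topologicalType) (F : S -> T -> R)
    (c : R) :
  feebly_compact S -> feebly_compact T ->
  separately_continuous F -> box_quasicontinuous F ->
  (forall x y, `|F x y| <= c) -> ~ crossing F.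
Proof.
move=> fS fT sF qF Fc [s [t [a [b [ab lo hi]]]]].
have [U [UU oU]] := ultraFilterLemma (eventually_filter : ProperFilter \oo).
have tail m : U [set n | (m <= n)%N] by apply: oU; exists m.
have [k Fk] := choice (fun y : T => ultrafilter_bounded_cvg UU (fun i => Fc (s i) y)).
have [g Fg] := choice (fun x : S => ultrafilter_bounded_cvg UU (fun j => Fc x (t j))).
have cg : continuous g.
  apply: (@pointwise_limit_continuous T S (fun y x => F x y) (t @ U)) => //.
    by case: sF.
  move=> y x O A B FO Ax By.
  have [C [D [oC oD C0 D0 [CA DB CD]]]] := qF x y O B A FO By Ax.
  by exists D, C; split => //; split => // u v Du Cv; exact: CD.
have ga i : g (s i) <= a.
  apply: (cvgr_to_le (Fg (s i))); apply: filterS (tail i) => j /= ij; exact: lo.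
have kb j : b <= k (t j).
  apply: (cvgr_to_ge (Fk (t j))); apply: filterS (tail j.+1) => i /= ij; exact: hi.
have [l gl] : exists l : R, (g \o s) @ U --> l.
  apply: (ultrafilter_bounded_cvg (c := c)) => i; rewrite /= ler_norml; apply/andP; split.
    apply: (cvgr_to_ge (Fg (s i))); apply: nearW => j.
    by have := Fc (s i) (t j); rewrite ler_norml => /andP[].
  apply: (cvgr_to_le (Fg (s i))); apply: nearW => j.
  by have := Fc (s i) (t j); rewrite ler_norml => /andP[].
have la : l <= a by apply: (cvgr_to_le gl); apply: nearW => i; exact: ga.
have : \forall y \near t @ U, k y <= (l + b) / 2.
  apply: (@iterated_limit_le _ _ F (s @ U) (t @ U) g k l) => //.
  by rewrite midf_lt// (le_lt_trans la).
move=> H; have [j /= kj] := filter_ex (H : U (t @^-1` _)).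
have : b <= (l + b) / 2 by exact: le_trans (kb j) kj.
by rewrite leNgt midf_lt// (le_lt_trans la).
Qed.

(** If [k > b] arbitrarily close to [y0], a crossing is built alternately: some [x] with
    [F x y0 < a] keeps [F x < a] near [y0], and a nearby [y] with [k y > b] has [F x y > b] for
    [K]-many [x]. *)
Lemma not_crossing_limit_le (S : Type) (T : topologicalType) (F : S -> T -> R)
    (K : set_system S) (k : T -> R) (y0 : T) (b : R) :
  ProperFilter K -> (forall x, {for y0, continuous (F x)}) ->
  (forall y, F^~ y @ K --> k y) -> ~ crossing F -> k y0 < b ->
  \forall y \near y0, k y <= b.
Proof.
move=> PK cF Fk nF kb; apply: contrapT => nk; apply: nF.
have [a [ka ab]] : exists a, k y0 < a /\ a < b.
  by exists ((k y0 + b) / 2); rewrite midf_lt// midf_lt.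
have [|A KA|y A kyb KA|N Ny0|s [t [_ lo hi _]]] := @alternating_sequences S T
    K (nbhs y0) [set y | b < k y]
    (fun x => [set y | F x y < a]) (fun x => [set y | b < F x y]) _.
- exact: filterT.
- have Ka : K [set x | F x y0 < a] := Fk y0 _ (lt_nbhsl ka).
  have [x [Ax Fx]] := filter_ex (filterI KA Ka).
  by exists x => //; exact: (cF x _ (lt_nbhsl Fx)).
- exact: (filterI KA (Fk y [set z | b < z] (lt_nbhsr kyb) : K [set x | b < F x y])).
- apply: contrapT => H; apply: nk; apply: filterS Ny0 => y Ny.
  by rewrite leNgt; apply/negP => yb; apply: H; exists y.
exists s, t, a, b; split => // i j ij; first exact/ltW/lo.
exact/ltW/hi.
Qed.

(** The absence of crossings of [F] gives upper, that of crossings of [- F] lower semicontinuity. *)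
Lemma not_crossing_limit_continuous (S : Type) (T : topologicalType)
    (F : S -> T -> R) (K : set_system S) (k : T -> R) :
  ProperFilter K -> (forall x, continuous (F x)) ->
  (forall y, F^~ y @ K --> k y) ->
  ~ crossing F -> ~ crossing (fun x y => - F x y) -> continuous k.
Proof.
move=> PK cF Fk nF nF' y0; apply: near_le_cvg => b kb.
  by apply: not_crossing_limit_le PK _ Fk nF kb => x; exact: cF.
have : \forall y \near y0, - k y <= - b.
  apply: (not_crossing_limit_le (k := fun y => - k y) PK _ _ nF').
  - by move=> x; apply: cvgN; exact: cF.
  - by move=> y; apply: cvgN; exact: Fk.
  - by rewrite ltrN2.
by apply: filterS => y; rewrite lerN2.
Qed.

End two_variables.

(** * Pseudocompactness and sequences of open sets *)

(** Nonempty open sets without a cluster point are locally finite. With bumps [phi n] that vanish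
    off [U n] and equal 1 at [a n], the sum of all [n%:R * phi n] is continuous and unbounded. *)
Lemma pseudocompact_feebly_compact (R : realType) (T : topologicalType) :
  pseudocompact R T -> completely_regular_space T -> feebly_compact T.
Proof.
move=> pcT crT U oU U0; apply: contrapT => nU.
have [W /(@choice _ nat)[m WU]] : {W : T -> set T & forall x, exists m, nbhs x (W x) /\
    forall n, (m <= n)%N -> U n `&` W x = set0}.
  apply: (@choice _ _ (fun x W => exists m, nbhs x W /\
    forall n, (m <= n)%N -> U n `&` W = set0)) => x.
  apply: contrapT => H; apply: nU; exists x => W Wx m.
  apply: contrapT => H'; apply: H; exists W, m; split => // n mn.
  by rewrite -nonemptyPn => UW; apply: H'; exists n.
have [a Ua] := choice U0.
pose bump n (f : T -> R) := [/\ continuous f, forall x, 0 <= f x, f (a n) = 1 &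
  forall x, ~ U n x -> f x = 0].
have [phi phiP] : {phi : nat -> T -> R & forall n, bump n (phi n)}.
  apply: (@choice _ _ bump) => n; have : uniform_separator [set a n] (~` U n).
    by apply: crT; [rewrite closedC|apply].
  move=> /(@uniform_separatorP _ R)[f [cf f01 f0 f1]].
  exists (fun x => 1 - f x); split.
  - by move=> x; apply: cvgB; [exact: cvg_cst|exact: cf].
  - move=> x; have := f01 (f x) (ex_intro2 _ _ x I erefl).
    by rewrite /= in_itv /= subr_ge0 => /andP[].
  - by rewrite (f0 (f (a n)))//= ?subr0//; exists (a n).
  - by move=> x nUx; rewrite (f1 (f x))//= ?subrr//; exists x.
pose s n x : R := \sum_(0 <= i < n) i%:R * phi i x.
have s_const n k x : (forall i, (n <= i)%N -> phi i x = 0) -> (n <= k)%N -> s k x = s n x.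
  move=> phi0 nk; rewrite /s (big_cat_nat (n := n))//= [X in _ + X]big_nat_cond.
  by rewrite [X in _ + X]big1 ?addr0// => i /andP[/andP[ni _] _]; rewrite phi0// mulr0.
have Wphi x y i : W x y -> (m x <= i)%N -> phi i y = 0.
  move=> Wxy mi; have [_ _ _] := phiP i; apply => Uy.
  by have [_ /(_ i mi)] := WU x; apply/eqP/set0P; exists y.
have sW x y k : W x y -> (m x <= k)%N -> s k y = s (m x) y.
  by move=> Wxy; apply: s_const => i; exact: Wphi.
have WW x : W x x by have [/nbhs_singleton] := WU x.
(* The infinite sum: on all of [W x] only terms below [m x] can be nonzero. *)
pose f x := s (m x) x.
have fE x y : W x y -> f y = s (m x) y.
  move=> Wxy; rewrite /f -(sW x y (maxn (m x) (m y)))// ?leq_maxl//.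
  by rewrite -(sW y y (maxn (m x) (m y)))// ?leq_maxr.
have cs n : continuous (s n).
  elim: n => [|n IH] x.
    by rewrite (_ : s 0%N = cst 0); [exact: cvg_cst|apply/funext => y; rewrite /s big_nil].
  rewrite (_ : s n.+1 = fun y => s n y + n%:R * phi n y); last first.
    by apply/funext => y; rewrite /s big_nat_recr.
  apply: cvgD; first exact: IH.
  by apply: cvgM; [exact: cvg_cst|have [cphi _ _ _] := phiP n; exact: cphi].
have cf : continuous f.
  move=> x; rewrite /continuous_at.
  have fx : s (m x) @ x --> f x by exact: cs.
  apply: cvg_trans fx; apply: near_eq_cvg.
  by have [Wx _] := WU x; apply: filterS Wx => y Wxy; exact: (esym (fE _ _ Wxy)).
have [M [_ fM]] := pcT f cf.
have fa n : n%:R <= f (a n).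
  (* The partial sum is lengthened to contain the term of index [n], whose value at [a n] is [n]. *)
  have Waa := WW (a n); rewrite /f -(sW _ _ (maxn (m (a n)) n.+1) Waa (leq_maxl _ _)).
  rewrite /s (bigD1_seq n) /=; last 2 first.
  - by rewrite mem_index_iota /= leq_maxr.
  - exact: iota_uniq.
  have [_ phi0 -> _] := phiP n; rewrite mulr1 lerDl; apply: sumr_ge0 => i _.
  by apply: mulr_ge0 => //; have [_ + _ _] := phiP i; apply.
have := fM (M + 1); rewrite ltrDl ltr01 => /(_ isT).
have [n Mn] : exists n : nat, M + 1 < n%:R.
  exists (Num.bound (`|M + 1|)); apply: le_lt_trans (ler_norm _) _.
  by rewrite archi_boundP.
move=> /(_ (a n) I) /=; apply/negP; rewrite -ltNge.
by apply: lt_le_trans Mn _; apply: le_trans (fa n) (ler_norm _).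
Qed.

(** * Continuity into products and subspaces *)

Lemma ptws_continuous (S : topologicalType) (I : eqType)
    (K : I -> topologicalType) (f : S -> prod_topology K) :
  (forall i, continuous (fun x => f x i)) -> continuous f.
Proof.
move=> cf x; apply/cvg_sup => i.
by apply: continuous_comp_initial; exact: cf.
Qed.

Lemma set_val_continuous (T : topologicalType) (A : set T) :
  continuous (set_val : A -> T).
Proof. exact: initial_continuous. Qed.

Lemma set_type_continuous (S T : topologicalType) (A : set T) (f : S -> A) :
  continuous (set_val \o f) -> continuous f.
Proof. exact: continuous_comp_initial. Qed.

Lemma continuous_dist (R : realType) (T : topologicalType) (f : T -> R) (c : R) :
  continuous f -> continuous (fun x => `|f x - c|).
Proof.
move=> cf x; apply: (continuous_comp (f := fun y => f y - c)
  (g := fun r : R => `|r|)); last exact: norm_continuous.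
by apply: cvgB; [exact: cf|exact: cvg_cst].
Qed.

(** * The Stone-Cech compactification *)

Section stone_cech_theory.
Context (R : realType) (X : topologicalType).
Local Notation Z := (stone_cech R X).
Local Notation eta := (@stone_cech_unit R X).
Local Notation I := (unit_interval R).

Definition sc_coord (phi : continuousType X I) (z : Z) : R :=
  \val (\val z phi).

Lemma sc_proj_continuous (phi : continuousType X I) :
  continuous (fun z : Z => \val z phi).
Proof.
move=> z; apply: (continuous_comp (f := \val : Z -> _) (g := proj phi)).
  exact: set_val_continuous.
exact: proj_continuous.
Qed.

Lemma sc_coord_continuous phi : continuous (sc_coord phi).
Proof.
move=> z; apply: (continuous_comp (f := fun z : Z => \val z phi)).
  exact: sc_proj_continuous.
exact: set_val_continuous.
Qed.

Lemma sc_coord_bound phi z : `|sc_coord phi z| <= 1.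
Proof.
have := set_valP (\val z phi); rewrite /= in_itv /= /sc_coord => /andP[p0 p1].
by rewrite ger0_norm.
Qed.

Lemma sc_continuous (S : topologicalType) (f : S -> Z) :
  (forall phi, continuous (fun x => sc_coord phi (f x))) -> continuous f.
Proof.
move=> cf; apply: set_type_continuous; apply: ptws_continuous => phi.
by apply: set_type_continuous; exact: cf.
Qed.

Lemma sc_unit_continuous : continuous eta.
Proof.
apply: sc_continuous => phi x; apply: continuous_comp; first exact: cts_fun.
exact: set_val_continuous.
Qed.

Lemma sc_unit_dense (p : Z) W : nbhs p W -> exists x, W (eta x).
Proof.
move=> [_ [[B oB <-] Bp BW]].
have [_ [[x _ <-] Bx]] := set_valP p _ (open_nbhs_nbhs (conj oB Bp)).
by exists x; apply: BW.
Qed.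

(** The coordinates of [u] define a continuous self-map [T] of the cube with [T (cube_eval x)] equal
    to [u x], so [T] maps the closure of the image of [X] into itself. [u'] is quantified before
    continuity is assumed, so that choice yields one operator on all functions [u]. *)
Lemma sc_extension (u : X -> Z) : exists u' : Z -> Z,
  continuous u -> continuous u' /\ forall x, u' (eta x) = u x.
Proof.
have [cu|nu] := pselect (continuous u); last by exists id.
have cphi (phi : continuousType X I) : continuous (fun x => \val (u x) phi).
  move=> x; apply: (continuous_comp (g := fun z : Z => \val z phi)).
    exact: cu.
  exact: sc_proj_continuous.
pose T (z : tychonoff_cube R X) : tychonoff_cube R X :=
  fun phi => z (mkcts (cphi phi)).
have cT : continuous T.
  by apply: ptws_continuous => phi; exact: proj_continuous.
have TZ (z : Z) : closure (range (@cube_eval R X)) (T (\val z)).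
  apply: (@closed_closure _ (range (@cube_eval R X))) => A /cT/(set_valP z)[_ [[x _ <-] Ax]].
  exists (T (cube_eval x)); split => //.
  rewrite (_ : T _ = \val (u x)); last by [].
  exact: set_valP.
exists (fun z => SigSub (mem_set (TZ z))) => _; split.
  apply: set_type_continuous => z.
  by apply: (continuous_comp (f := \val : Z -> _) (g := T)); [exact: set_val_continuous|exact: cT].
by move=> x; apply: val_inj.
Qed.

(** By density the neighborhoods [V n] of [p] have nonempty open preimages in [X]; at a cluster
    point of these each [h i] takes its value at [p]. *)
Lemma sc_unit_Gdelta_dense (h : nat -> Z -> R) (p : Z) :
  feebly_compact X -> (forall n, continuous (h n)) ->
  exists x, forall n, h n (eta x) = h n p.
Proof.
move=> fX ch.
pose V n := \bigcap_(i in `I_n) [set z | `|h i z - h i p| < n.+1%:R^-1].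
have cd i : continuous (fun z => `|h i z - h i p|).
  exact: continuous_dist.
have oV n : open (V n).
  rewrite /V bigcap_mkord; elim/big_ind: _ => [|A B|i _]; first exact: openT.
    exact: openI.
  exact: open_ltc.
have [x xV] : exists x, seq_cluster (fun n => eta @^-1` (V n)) x.
  apply: fX => n.
    by apply: open_comp => // x _; exact: sc_unit_continuous.
  have [|x Vx] := @sc_unit_dense p (V n); last by exists x.
  apply: open_nbhs_nbhs; split; first exact: oV.
  by move=> i _ /=; rewrite subrr normr0 invr_gt0.
exists x => i; apply/eqP; rewrite -subr_eq0 -normr_le0 leNgt; apply/negP => d0.
have [n nd] : exists n : nat, n.+1%:R^-1 < `|h i (eta x) - h i p|.
  pose d := `|h i (eta x) - h i p|.
  exists (Num.bound d^-1); rewrite invf_plt ?posrE//.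
  apply: lt_le_trans (archi_boundP _) _; first by rewrite invr_ge0 ltW.
  by rewrite ler_nat.
have : `|h i (eta x) - h i p| <= n.+1%:R^-1; last by rewrite leNgt nd.
(* From [i.+1] on, [V k] controls [h i]; from [n] on, it does so within [n.+1%:R^-1]. *)
apply: (seq_cluster_le (m := maxn n i.+1) xV (f := fun x => `|h i (eta x) - h i p|)).
  apply: (continuous_comp (f := eta) (g := fun z => `|h i z - h i p|)).
    exact: sc_unit_continuous.
  exact: cd.
move=> k y; rewrite geq_max => /andP[nk ik] /(_ i ik) /= /ltW /le_trans; apply.
by rewrite lef_pV2 ?posrE// ler_nat.
Qed.

Lemma sc_unit_inj : tychonoff_space X -> injective eta.
Proof.
move=> [crX hX] x y /(congr1 \val) /= exy; apply: contrapT => xy.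
have [f [cf f01 fx fy]] : exists f : X -> R,
    [/\ continuous f, range f `<=` `[0, 1], f @` [set x] `<=` [set 0] &
      f @` [set y] `<=` [set 1]].
  apply/uniform_separatorP; apply: crX; last exact: xy.
  exact/accessible_closed_set1/hausdorff_accessible.
pose g z : I := SigSub (mem_set (f01 _ (imageT f z))).
have cg : continuous g by apply: set_type_continuous; exact: cf.
have := congr1 (fun c : tychonoff_cube R X => \val (c (mkcts cg))) exy.
rewrite /= (fx (f x))//; last by exists x.
by rewrite (fy (f y)); [move/eqP; rewrite eq_sym oner_eq0|exists y].
Qed.

End stone_cech_theory.

(** * Extension one coordinate at a time *)

Section dfwith_theory.
Context (I : eqType) (T : Type).
Implicit Types (z : I -> T) (i j : I).
Local Notation upd := (@dfwith I (fun=> T)).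

Lemma dfwithC z i j a b : i != j -> upd (upd z i a) j b = upd (upd z j b) i a.
Proof.
move=> ij; apply/funext => k.
have [jk|jk] := eqVneq j k.
  by rewrite -jk dfwithin dfwithout// dfwithin.
rewrite dfwithout//; have [<-|ik] := eqVneq i k; first by rewrite !dfwithin.
by rewrite !dfwithout.
Qed.

Lemma dfwith_dfwith z i a b : upd (upd z i a) i b = upd z i b.
Proof.
apply/funext => k; have [<-|ik] := eqVneq i k; first by rewrite !dfwithin.
by rewrite !dfwithout.
Qed.

Lemma dfwith_id z i : upd z i (z i) = z.
Proof.
apply/funext => k; have [<-|ik] := eqVneq i k; first by rewrite dfwithin.
by rewrite dfwithout.
Qed.

End dfwith_theory.

Lemma comp_dfwith (I : eqType) (S T : Type) (e : S -> T) (x : I -> S) i a :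
  e \o @dfwith I (fun=> S) x i a = @dfwith I (fun=> T) (e \o x) i (e a).
Proof.
apply/funext => k; have [<-|ik] := eqVneq i k; first by rewrite /= !dfwithin.
by rewrite /= !dfwithout.
Qed.

(** What the extension uses of the compactification. Continuity into [Z] is tested by bounded real
    functions, because crossings concern such functions. *)
Record stone_cech_like (R : realType) (X Z : topologicalType) (eta : X -> Z) :
    Prop := StoneCechLike {
  unit_continuous : continuous eta;
  unit_dense : forall (p : Z) W, nbhs p W -> exists x, W (eta x);
  unit_Gdelta_dense : forall (h : nat -> Z -> R) p, (forall n, continuous (h n)) ->
    exists x, forall n, h n (eta x) = h n p;
  unit_extension : forall u : X -> Z, exists u' : Z -> Z,
    continuous u -> continuous u' /\ forall x, u' (eta x) = u x;
  coord_continuous : forall (S : topologicalType) (f : S -> Z),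
    (forall h : Z -> R, continuous h -> (forall z, `|h z| <= 1) ->
      continuous (h \o f)) -> continuous f }.

Section extension.
Context (R : realType) (X Z P : topologicalType) (eta : X -> Z) (n : nat).
Context (op : P -> ('I_n -> X) -> X).
Implicit Types (z : 'I_n -> Z) (k : nat) (f : P).
Local Notation upd := (@dfwith 'I_n (fun=> Z)).

(** The consequence of the Grothendieck property that gives continuity in the signature variable. *)
Definition limit_closed := forall (F : X -> P -> R) (K : set_system X) (k : P -> R),
  ProperFilter K -> separately_continuous F ->
  (forall f, F^~ f @ K --> k f) -> continuous k.

(** After [k] steps the coordinates below [k] range over [Z], the others still over the image of
    [X]. *)
Definition extension_dom k z := forall i : 'I_n, (k <= i)%N -> range eta (z i).

(* The values of [g] outside [extension_dom k] are junk. *)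
Record partial_extension k (g : P -> ('I_n -> Z) -> Z) : Prop := PartialExtension {
  pext_param : forall z, extension_dom k z -> continuous (g^~ z);
  pext_unit : forall f z i, extension_dom k z ->
    continuous (fun x => g f (upd z i (eta x)));
  pext_ext : forall f z (i : 'I_n), extension_dom k z -> (i < k)%N ->
    continuous (fun y => g f (upd z i y));
  pext_crossing : forall f z i j (h : Z -> R), extension_dom k z -> i != j ->
    continuous h -> (forall y, `|h y| <= 1) ->
    ~ crossing (fun x y => h (g f (upd (upd z i (eta x)) j (eta y))));
  pext_agree : forall f x, g f (eta \o x) = eta (op f x) }.

Arguments pext_param {k g} _ z _.
Arguments pext_unit {k g} _ f z i _.
Arguments pext_ext {k g} _ f z i _ _.
Arguments pext_crossing {k g} _ f z i j h _ _ _ _.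
Arguments pext_agree {k g} _ f x.

(** The trace on [X] of the neighborhood filter of [p]; limits along it recover values at [p]. *)
Definition trace (p : Z) : set_system X :=
  filter_from (nbhs p) (fun W => eta @^-1` W).

Lemma trace_cvg (V : topologicalType) (h : Z -> V) (p : Z) :
  {for p, continuous h} -> (h \o eta) @ trace p --> h p.
Proof. by move=> ch A /ch hA; exists (h @^-1` A). Qed.

Context (sc : stone_cech_like R eta).

Lemma trace_proper p : ProperFilter (trace p).
Proof.
apply: filter_from_proper; last by move=> W /(unit_dense sc).
apply: filter_from_filter; first by exists setT; exact: filterT.
by move=> A B pA pB; exists (A `&` B) => //; exact: filterI.
Qed.

(** Each [t j] is replaced by a point of [X] at which the countably many functions [F (s i)] have
    the same values. *)
Lemma crossing_unit (S : Type) (F : S -> Z -> R) :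
  (forall x, continuous (F x)) -> crossing F -> crossing (fun x y => F x (eta y)).
Proof.
move=> cF [s [t [a [b [ab lo hi]]]]].
have [t' tE] := choice (fun j => unit_Gdelta_dense sc (t j) (fun i => cF (s i))).
by exists s, t', a, b; split => // i j ij; rewrite tE; [exact: lo|exact: hi].
Qed.

Lemma dom_unit k z i x : extension_dom k z -> extension_dom k (upd z i (eta x)).
Proof.
move=> Dz j kj; have [<-|ij] := eqVneq i j; first by rewrite dfwithin; exists x.
by rewrite dfwithout//; exact: Dz.
Qed.

Lemma dom_ext k z (i : 'I_n) y :
  (i < k)%N -> extension_dom k z -> extension_dom k (upd z i y).
Proof.
move=> ik Dz j kj; have [ij|ij] := eqVneq i j.
  by move: kj; rewrite -ij leqNgt ik.
by rewrite dfwithout//; exact: Dz.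
Qed.

Lemma dom_pred k z (i : 'I_n) x :
  i = k :> nat -> extension_dom k.+1 z -> extension_dom k (upd z i (eta x)).
Proof.
move=> ik Dz j kj; have [<-|ij] := eqVneq i j; first by rewrite dfwithin; exists x.
rewrite dfwithout//; apply: Dz; rewrite ltn_neqAle kj andbT -ik.
by apply: contra ij => /eqP /val_inj ->.
Qed.

(** Coordinate [i0], of index [k], is extended continuously. The new values are limits of values of
    [g] along a trace filter, hence continuous in the parameter by [limit_closed] and in another
    coordinate by the absence of crossings. *)
Lemma partial_extension_step k g : limit_closed -> (k < n)%N ->
  partial_extension k g -> exists g', partial_extension k.+1 g'.
Proof.
move=> PP kn pg; pose i0 := Ordinal kn.
have [ext extP] := choice (unit_extension sc).
exists (fun f z => ext (fun x => g f (upd z i0 (eta x))) (z i0)).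
set g' := fun f z => _.
have pred z x : extension_dom k.+1 z -> extension_dom k (upd z i0 (eta x)).
  exact: dom_pred.
(* A point of [X], found by density; it fills coordinate [i0] wherever that is overwritten
   afterwards. *)
have [pt _] : {pt : Z -> X & Z -> True}.
  apply: (@choice _ _ (fun _ _ => True)) => p.
  by have [x _] := unit_dense sc (filterT : nbhs p setT); exists x.
have c f z : extension_dom k.+1 z -> continuous (fun x => g f (upd z i0 (eta x))).
  move=> Dz; have := pext_unit pg f _ i0 (pred z (pt (z i0)) Dz).
  by under eq_fun do rewrite dfwith_dfwith.
have gE f z y : g' f (upd z i0 y) = ext (fun x => g f (upd z i0 (eta x))) y.
  rewrite /g' dfwithin; congr (ext _ _).
  by apply/funext => x; rewrite dfwith_dfwith.
have gU f z x : extension_dom k.+1 z ->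
    g' f (upd z i0 (eta x)) = g f (upd z i0 (eta x)).
  by move=> Dz; rewrite gE; have [_ ->] := extP _ (c f z Dz).
have gC f z : extension_dom k.+1 z -> continuous (fun y => g' f (upd z i0 y)).
  move=> Dz; under eq_fun do rewrite gE.
  by have [] := extP _ (c f z Dz).
(* [p] is a separate variable so that the filter stays fixed while other coordinates of [z] move. *)
have gL f z (h : Z -> R) p : extension_dom k.+1 z -> continuous h -> p = z i0 ->
    (fun x => h (g f (upd z i0 (eta x)))) @ trace p --> h (g' f z).
  move=> Dz ch ->; pose H y := h (g' f (upd z i0 y)).
  rewrite (_ : (fun x => _) = H \o eta); last first.
    by apply/funext => x; rewrite /H /= gU.
  rewrite (_ : h (g' f z) = H (z i0)); last by rewrite /H dfwith_id.
  apply: trace_cvg; apply: (continuous_comp (f := fun y => g' f (upd z i0 y))).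
    exact: gC.
  exact: ch.
(* Used with [e := eta] for continuity on [X] and with [e := id] for continuity on [Z]; [crosse]
   brings crossings back to [X]. *)
have limit f z i (Y : topologicalType) (e : Y -> Z) :
    extension_dom k.+1 z -> i != i0 ->
    (forall y, extension_dom k.+1 (upd z i (e y))) ->
    (forall z', extension_dom k z' -> continuous (fun y => g f (upd z' i (e y)))) ->
    (forall F : X -> Z -> R, (forall x, continuous (F x \o e)) ->
      crossing (fun x y => F x (e y)) -> crossing (fun x y => F x (eta y))) ->
    continuous (fun y => g' f (upd z i (e y))).
  move=> Dz ii0 De ce crosse; apply: (coord_continuous sc) => h ch h1.
  have cF (h' : Z -> R) x : continuous h' ->
      continuous (fun y => h' (g f (upd (upd z i (e y)) i0 (eta x)))).
    move=> ch' y; under eq_fun do rewrite dfwithC//.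
    apply: (continuous_comp (f := fun y => g f (upd (upd z i0 (eta x)) i (e y)))).
      by apply: ce; exact: pred.
    exact: ch'.
  have nF (h' : Z -> R) : continuous h' -> (forall y, `|h' y| <= 1) ->
      ~ crossing (fun x y => h' (g f (upd (upd z i (e y)) i0 (eta x)))).
    move=> ch' h'1; move=> /(crosse (fun x w => h' (g f (upd (upd z i w) i0 (eta x))))).
    move=> /(_ (fun x => cF h' x ch')).
    have := pext_crossing pg f _ i0 i h' (pred z (pt (z i0)) Dz) _ ch' h'1.
    rewrite eq_sym => /(_ ii0); apply: contra_not.
    move=> [s [t [a [b [ab lo hi]]]]]; exists s, t, a, b; split => // u v uv.
      by rewrite dfwith_dfwith -dfwithC//; exact: lo.
    by rewrite dfwith_dfwith -dfwithC//; exact: hi.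
  have PK := trace_proper (z i0).
  apply: (not_crossing_limit_continuous PK (fun x => cF h x ch)).
  - by move=> y; apply: gL => //; rewrite dfwithout.
  - exact: nF.
  - apply: (nF (fun y => - h y)); last by move=> y; rewrite normrN.
    by move=> y; apply: (continuous_comp (f := h)); [exact: ch|exact: continuous_opp].
split.
- move=> z Dz; apply: (coord_continuous sc) => h ch h1.
  have PK := trace_proper (z i0).
  apply: (PP (fun x f => h (g f (upd z i0 (eta x)))) (trace (z i0))) => //.
    apply: separately_continuous_comp => //; split => [f|x]; first exact: c.
    by apply: (pext_param pg); exact: pred.
  by move=> f; exact: gL.
- move=> f z i Dz; have [->|ii0] := eqVneq i i0.
    by under eq_fun do rewrite gU//; exact: c.
  apply: limit => //; first by move=> y; exact: dom_unit.
  by move=> z' Dz'; exact: (pext_unit pg).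
- move=> f z i Dz; rewrite ltnS leq_eqVlt => /orP[/eqP ik|ik].
    by rewrite (_ : i = i0); [exact: gC|exact: val_inj].
  apply: (limit f z i Z id) => //.
  + by apply/eqP => /(congr1 val) /= ik'; move: ik; rewrite ik' ltnn.
  + by move=> y; apply: dom_ext => //; exact: ltnW.
  + by move=> z' Dz'; exact: (pext_ext pg).
  + by move=> F cF; exact: crossing_unit.
- move=> f z i j h Dz ij ch h1 [s [t [a [b [ab lo hi]]]]].
  (* A single [u] reproducing all these values turns the crossing into one of [g]. *)
  suff [u uE] : exists u, forall l m,
      h (g f (upd (upd (upd z i0 (eta u)) i (eta (s l))) j (eta (t m)))) =
      h (g' f (upd (upd z i (eta (s l))) j (eta (t m)))).
    apply: (pext_crossing pg f _ i j h (pred z u Dz) ij ch h1).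
    by exists s, t, a, b; split => // l m lm; rewrite uE; [exact: lo|exact: hi].
  (* If [i] or [j] is [i0], that coordinate is already overwritten by a point of [X], and any [u]
     works. *)
  have [ii0|ii0] := eqVneq i i0.
    exists (pt (z i0)) => l m; rewrite -ii0 dfwith_dfwith dfwithC// ii0 gU//.
    exact: dom_unit.
  have [ji0|ji0] := eqVneq j i0.
    exists (pt (z i0)) => l m; rewrite ji0 gU; last exact: dom_unit.
    rewrite (@dfwithC _ _ z i0 i) ?dfwith_dfwith//.
    by rewrite eq_sym.
  (* Pairs [(l, m)] are coded by one index to obtain a sequence of functions; the other codes get
     zero. *)
  pose H q y : R := if unpickle q is Some (l, m) then
    h (g' f (upd (upd (upd z i (eta (s l))) j (eta (t m))) i0 y)) else 0.
  have cH q : continuous (H q).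
    rewrite /H; case: (unpickle q) => [[l m]|]; last by move=> y; exact: cvg_cst.
    move=> y; apply: (continuous_comp (f := fun y =>
      g' f (upd (upd (upd z i (eta (s l))) j (eta (t m))) i0 y))); last exact: ch.
    by apply: gC; do 2 apply: dom_unit.
  have [u uH] := unit_Gdelta_dense sc (z i0) cH.
  exists u => l m; have := uH (pickle (l, m)); rewrite /H pickleK gU; last first.
    by do 2 apply: dom_unit.
  have <- : upd (upd z i (eta (s l))) j (eta (t m)) i0 = z i0.
    by rewrite dfwithout// dfwithout.
  rewrite dfwith_id => <-; congr (h (g f _)).
  by rewrite [RHS]dfwithC// [in RHS](dfwithC _ _ _ ii0).
- move=> f x; have Dx : extension_dom k.+1 (eta \o x) by move=> i _; exists (x i).
  have := gU f (eta \o x) (x i0) Dx.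
  by rewrite (dfwith_id (eta \o x) i0) => ->; exact: (pext_agree pg).
Qed.

End extension.

(** * Continuity in the signature variable *)

(** By compactness the image of [K] has a cluster point [gamma] in [Cp R E]; evaluating at each [e]
    along a finer filter identifies [k] with the continuous [gamma]. *)
Lemma grothendieck_limit_closed (R : realType) (X E : topologicalType) :
  grothendieck_pair R X E -> @limit_closed R X E.
Proof.
move=> gr F K k PK [cF1 cF2] Fk.
pose phi x : Cp R E := mkcts (cF2 x).
have cphi : continuous phi.
  apply: continuous_comp_initial; apply: ptws_continuous => e; exact: cF1.
have := gr phi cphi (phi @ K) _ _.
case=> [|gamma [_]].
  by apply: (@filterE _ K) => x; apply: subset_closure; exists x.
rewrite cluster_cvgE => -[G PG [Ggamma KG]].
have eval e : continuous (fun h : Cp R E => (h : continuousType E R) e).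
  move=> h; apply: (continuous_comp (f := fun h : Cp R E => (h : E -> R) : {ptws E -> R})
    (g := proj e)); first exact: initial_continuous.
  exact: proj_continuous.
suff -> : k = (gamma : continuousType E R) by exact: cts_fun.
apply/funext => e.
have PGe : ProperFilter ((fun h : Cp R E => (h : continuousType E R) e) @ G).
  exact: fmap_proper_filter.
apply: (@cvg_unique _ _ _ PGe).
- exact: norm_hausdorff.
- by move=> A /Fk KA; apply: KG.
- by move=> A /eval hA; exact: Ggamma.
Qed.

Section zero_extension.
Context (R : realType) (E : topologicalType) (A : set E).

Definition zero_extension (f : A -> R) (e : E) : R :=
  if pselect (A e) is left Ae then f (SigSub (mem_set Ae)) else 0.

Lemma zero_extension_val f a : zero_extension f (\val a) = f a.
Proof.
rewrite /zero_extension; case: pselect => [Aa|]; last by case; exact: set_valP.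
by congr f; exact: val_inj.
Qed.

Lemma zero_extension_continuous f :
  clopen A -> continuous f -> continuous (zero_extension f).
Proof.
move=> [oA cA] cf e; have [Ae|nAe] := pselect (A e).
  move=> O; rewrite -[e]/(\val (SigSub (mem_set Ae) : A)) zero_extension_val => /cf.
  move=> [_ [[B oB <-] Be BO]].
  have : nbhs e (A `&` B) by apply: open_nbhs_nbhs; split; [exact: openI|].
  apply: filterS => x [Ax Bx]; rewrite /= -[x]/(\val (SigSub (mem_set Ax) : A)).
  by rewrite zero_extension_val; exact: BO.
move=> O; rewrite {1}/zero_extension; case: pselect => // _ /nbhs_singleton O0.
have : nbhs e (~` A) by apply: open_nbhs_nbhs; split => //; rewrite openC.
by apply: filterS => x nAx; rewrite /= /zero_extension; case: pselect.
Qed.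

End zero_extension.

(** Extension by zero from a clopen set preserves continuity and pointwise limits. *)
Lemma limit_closed_clopen (R : realType) (X E : topologicalType) (A : set E) :
  clopen A -> @limit_closed R X E -> @limit_closed R X A.
Proof.
move=> cA lE F K k PK [cF1 cF2] Fk.
suff ck : continuous (zero_extension k).
  move=> a; rewrite (_ : k = zero_extension k \o \val); last first.
    by apply/funext => b; rewrite /= zero_extension_val.
  apply: (continuous_comp (f := \val : A -> E)); last exact: ck.
  exact: set_val_continuous.
apply: (lE (fun x => zero_extension (F x)) K) => //.
  split=> [e|x]; last by apply: zero_extension_continuous.
  rewrite /zero_extension; case: pselect => [Ae|_]; first exact: cF1.
  by move=> x; exact: cvg_cst.
move=> e; rewrite /zero_extension; case: pselect => [Ae|_]; first exact: Fk.
exact: cvg_cst.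
Qed.

(** * Quasicontinuity in two coordinates *)

Lemma two_quasicontinuous_box (n : nat) (X : topologicalType)
    (Phi : ('I_n -> X) -> X) (x : 'I_n -> X) (i j : 'I_n) :
  @two_quasicontinuous 'I_n (fun=> X) X Phi -> i != j ->
  box_quasicontinuous (fun u v => Phi (dfwith (dfwith x i u) j v)).
Proof.
move=> qPhi ij u v O A B PO uA vB; pose C : set 'I_n := [set i; j].
have C2 : (C #<= `I_2)%card.
  rewrite (_ : C = (fun k => if k == 0%N then i else j) @` `I_2).
    exact: card_image_le.
  apply/seteqP; split=> [k [->|->]|_ [[|[|//]] _ <-]].
  - by exists 0%N.
  - by exists 1%N.
  - by left.
  - by right.
(* A continuous bijection onto the product over [C], with inverse given by the coordinates [ci] and
   [cj]. *)
pose psi (p : X * X) : prod_topology (fun b : C => X) :=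
  fun b => if \val b == i then p.1 else p.2.
have cpsi : continuous psi.
  apply: ptws_continuous => b p; rewrite /psi.
  by case: eqP => _; [exact: cvg_fst|exact: cvg_snd].
have iC : i \in C by rewrite inE; left.
have jC : j \in C by rewrite inE; right.
pose ci : C := SigSub iC; pose cj : C := SigSub jC.
have psii a b : psi (a, b) ci = a by rewrite /psi /= eqxx.
have psij a b : psi (a, b) cj = b by rewrite /psi /= eq_sym (negbTE ij).
have psiK z : psi (z ci, z cj) = z.
  apply/funext => b; rewrite /psi; case: eqP => [bi|bi] /=.
    by congr z; exact: val_inj.
  have [/= |bj] := set_valP b; first by [].
  by congr z; exact: val_inj.
have gl u' v' : glue_coords x (psi (u', v')) = dfwith (dfwith x i u') j v'.
  apply/funext => k; rewrite /glue_coords; case: eqP => [kC|kC].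
    rewrite /psi /=; have [ki|ki] := eqVneq k i.
      by rewrite ki dfwithout 1?eq_sym// dfwithin.
    have [|kj] := set_mem kC; first by move/eqP: ki.
    by rewrite kj dfwithin.
  have ik : i != k by apply/eqP => ik; apply: kC; rewrite -ik.
  have jk : j != k by apply/eqP => jk; apply: kC; rewrite -jk.
  by rewrite !dfwithout.
have pW : nbhs (psi (u, v)) [set z | A (z ci) /\ B (z cj)].
  have c k : continuous (fun z : prod_topology (fun b : C => X) => z k).
    exact: proj_continuous.
  have hA : nbhs (psi (u, v)) [set z | A (z ci)].
    by apply: (c ci (psi (u, v)) A); rewrite psii.
  have hB : nbhs (psi (u, v)) [set z | B (z cj)].
    by apply: (c cj (psi (u, v)) B); rewrite psij.
  have FF : Filter (nbhs (psi (u, v))) by exact: nbhs_filter.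
  exact: filterI hA hB.
have [|U [oU [z Uz] UW UO]] := qPhi C x C2 (psi (u, v)) O _ _ pW.
  by rewrite gl.
(* The box comes from the interiors of the sides of a product neighborhood inside the preimage of
   [U]. *)
have : nbhs (z ci, z cj) (psi @^-1` U).
  by apply: cpsi; rewrite psiK; exact: open_nbhs_nbhs.
case=> -[V W] /= [nV nW] VW.
exists V^°, W^°; split.
- exact: open_interior.
- exact: open_interior.
- by exists (z ci).
- by exists (z cj).
have VWU a b : V^° a -> W^° b -> U (psi (a, b)).
  by move=> /interior_subset Va /interior_subset Wb; exact: (VW (a, b)).
split.
- move=> a Va; have [+ _] := UW _ (VWU _ _ Va (nW : W^° (z cj))).
  by rewrite psii.
- move=> b Wb; have [_] := UW _ (VWU _ _ (nV : V^° (z ci)) Wb).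
  by rewrite psij.
- by move=> a b Va Wb; rewrite -gl; apply: UO; exists (psi (a, b)) => //; exact: VWU.
Qed.

(** * Extension of the operations to the compactification *)

Lemma stone_cech_is_like (R : realType) (X : topologicalType) :
  feebly_compact X -> stone_cech_like R (@stone_cech_unit R X).
Proof.
move=> fX; split.
- exact: sc_unit_continuous.
- exact: sc_unit_dense.
- by move=> h p ch; exact: sc_unit_Gdelta_dense.
- exact: sc_extension.
- move=> S f hf; apply: sc_continuous => phi.
  apply: (hf (sc_coord phi)); first exact: sc_coord_continuous.
  exact: sc_coord_bound.
Qed.

(** The start of the induction: [rho] inverts [eta] on its range, with default [x0] elsewhere, and
    2-quasicontinuity excludes crossings. *)
Lemma partial_extension0 (R : realType) (X Z P : topologicalType)
    (eta : X -> Z) (n : nat) (op : P -> ('I_n -> X) -> X) (x0 : X) :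
  feebly_compact X -> continuous eta -> injective eta ->
  (forall x, continuous (op^~ x)) ->
  (forall f x i, continuous (fun y => op f (dfwith x i y))) ->
  (forall f, @two_quasicontinuous 'I_n (fun=> X) X (op f)) ->
  exists g, partial_extension R eta op 0 g.
Proof.
move=> fX ceta ieta cop1 cop2 qop.
have [rho rhoP] : {rho : Z -> X & forall z, forall x, eta x = z -> rho z = x}.
  apply: (@choice _ _ (fun z y => forall x, eta x = z -> y = x)) => z.
  have [[x <-]|H] := pselect (exists x, eta x = z).
    by exists x => x' /ieta.
  by exists x0 => x xz; case: H; exists x.
have rhoK x : rho (eta x) = x by exact: rhoP.
have rhoU (z : 'I_n -> Z) i x : rho \o dfwith z i (eta x) = dfwith (rho \o z) i x.
  by rewrite (comp_dfwith rho z i (eta x)) rhoK.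
exists (fun f z => eta (op f (rho \o z))); split.
- move=> z _ f; apply: (continuous_comp (f := op^~ (rho \o z))); last exact: ceta.
  exact: cop1.
- move=> f z i _ x; under eq_fun do rewrite rhoU.
  apply: (continuous_comp (f := fun y => op f (dfwith (rho \o z) i y))); last exact: ceta.
  exact: cop2.
- by [].
- move=> f z i j h _ ij ch h1.
  pose G u v := op f (dfwith (dfwith (rho \o z) i u) j v).
  pose F u v := h (eta (G u v)).
  have ch' : continuous (h \o eta).
    by move=> x; apply: continuous_comp; [exact: ceta|exact: ch].
  have : ~ crossing F.
    apply: (quasicontinuous_not_crossing (c := 1) fX fX).
    - apply: (@separately_continuous_comp _ _ _ _ G (h \o eta) ch').
      split=> [v|u]; last exact: cop2.
      by rewrite /G; under eq_fun do rewrite dfwithC//; exact: cop2.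
    - apply: (@box_quasicontinuous_comp _ _ _ _ G (h \o eta) ch').
      exact: two_quasicontinuous_box.
    - by move=> x y; exact: h1.
  apply: contra_not => -[s [t [a [b [ab lo hi]]]]]; exists s, t, a, b; split => // l m lm.
    by rewrite /F /G -!rhoU; exact: lo.
  by rewrite /F /G -!rhoU; exact: hi.
- move=> f x; congr (eta (op f _)); apply/funext => i; exact: rhoK.
Qed.

Theorem theorem7 (R : realType) (E : topologicalType) (En : nat -> set E)
    (X : topologicalType) (op : E_algebra En X)
    (sigE : continuous_signature En)
    (tychX : tychonoff_space X)
    (semiX : semitopological op)
    (pcX : pseudocompact R X)
    (grXE : grothendieck_pair R X E)
    (qcX : forall n : nat, Sp En n -> forall f : En n,
       @two_quasicontinuous 'I_n (fun=> X) X (op n f)) :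
  exists op' : E_algebra En (stone_cech R X),
    semitopological op' /\
    forall (n : nat) (f : En n) (x : 'I_n -> X),
      op' n f (fun i => stone_cech_unit R (x i)) = stone_cech_unit R (op n f x).
Proof.
have fX : feebly_compact X.
  by apply: (pseudocompact_feebly_compact pcX); case: tychX.
have sc := stone_cech_is_like R fX.
have PP n : @limit_closed R X (En n).
  apply: limit_closed_clopen; first by case: sigE.
  exact: grothendieck_limit_closed.
have op'P n : exists op' : En n -> ('I_n -> stone_cech R X) -> stone_cech R X,
    [/\ forall z, continuous (op'^~ z),
      forall f z i, continuous (fun y => op' f (dfwith z i y)) &
      forall f x, op' f (@stone_cech_unit R X \o x) = stone_cech_unit R (op n f x)].
  (* With no operation symbol or no argument tuple, everything is vacuous. *)
  have [[f0 [z0 _]]|nP] := pselect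
    (exists f : En n, exists z : 'I_n -> stone_cech R X, True); last first.
    have H (f : En n) (z : 'I_n -> stone_cech R X) : False by apply: nP; exists f, z.
    exists (fun f z => False_rect _ (H f z)).
    split=> [z f|f z|f x]; first by have := H f z.
      by have := H f z.
    by have := H f (@stone_cech_unit R X \o x).
  (* For [n = 0] the constant itself is a point of [X]; otherwise density provides one. *)
  have [x0 _] : exists x0 : X, True.
    case: n f0 z0 => [|n] f0 z0.
      have x : 'I_0 -> X by case.
      by exists (op 0%N f0 x).
    by have [x _] := unit_dense sc (filterT : nbhs (z0 ord0) setT); exists x.
  have [g0 pg0] : exists g, partial_extension R (@stone_cech_unit R X) (op n) 0 g.
    apply: partial_extension0 => //.
    - exact: sc_unit_continuous.
    - exact: sc_unit_inj.
    - by have [] := semiX n.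
    - by have [] := semiX n.
    - by move=> f; apply: qcX; exists (\val f); exact: set_valP.
  have [g pg] : exists g, partial_extension R (@stone_cech_unit R X) (op n) n g.
    suff : forall k, (k <= n)%N ->
      exists g, partial_extension R (@stone_cech_unit R X) (op n) k g by apply.
    elim=> [_|k IH kn]; first by exists g0.
    by have [g pg] := IH (ltnW kn); exact: (partial_extension_step sc (PP n) kn pg).
  (* After [n] steps no coordinate is restricted to the image of [X]. *)
  have D (z : 'I_n -> stone_cech R X) : extension_dom (@stone_cech_unit R X) n z.
    by move=> i ni; have := ltn_ord i; rewrite ltnNge ni.
  exists g; split=> [z|f z i|f x].
  - exact: (pext_param pg).
  - exact: (pext_ext pg).
  - exact: (pext_agree pg).
pose op' n := projT1 (cid (op'P n)).
exists op'; split=> [n|n f x]; rewrite /op'; case: cid => g [g1 g2 g3] //=.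
exact: g3.
Qed.
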